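(* Suppose there exist $\alpha\in\mathbb R_{++}^N$ and $\beta\in\mathbb R_{++}^M$ such that $q'_{ij}(p_j)=\alpha_i\beta_j$ for all $i\in N$, $j\in M$, and $p_j\in\mathbb R_+$. Define the scaled Lyapunov function $\tilde L$ on $\mathbb R_+^M$ by $$\tilde L(p)=\sum_{i\in N}\tilde V_i(p)+\sum_{j\in M}\beta_jp_js_j,\qquad \tilde V_i(p)=\max_{x_i\in[\mathbf 0,s]_{\mathbb Z}}\Bigl\{\frac{v_i(x_i)}{\alpha_i}-\sum_{j\in M}\beta_jp_jx_{ij}\Bigr\},$$ and let $d:\mathbb R_+^M\to\mathbb R_{++}^M$, $p\mapsto d_p$, be the direction map given by $(d_p)_j=1/\beta_j$ for each $j\in M$. Let $\underline p$ be the minimum equilibrium price vector. Then $\tilde L:\mathbb R_+^M\to\mathbb R_+$ is a polyhedral convex function, and $\tilde L$ and $d$ satisfy the following for any $p\le\underline p$: (i) the subdifferential of $\tilde L$ at $p$ satisfies $$\partial\tilde L(p)=d_p^{-1}\circ\Bigl(s-\sum_{i\in N}D_i(p)\Bigr);$$ (ii) the local optimality condition is equivalent to the non-negativity of directional derivatives: $$\mathbf 0\in\partial\tilde L(p)\iff \tilde L'(p;X):=\lim_{\varepsilon\to+0}\frac{\tilde L(p+\varepsilon(d_p\circ\chi_X))-\tilde L(p)}{\varepsilon}\ge 0\ \text{ for all }X\subseteq M.$$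
   Context: **Market model.** $M=\{1,\dots,m\}$ is the set of goods, $N=\{1,\dots,n\}$ with $n\ge 2$ the set of buyers, $s\in\mathbb Z_+^M$ the supply vector, and $[\mathbf 0,s]_{\mathbb Z}=\{x\in\mathbb Z_+^M : x\le s\}$ (vector inequalities are componentwise). $\mathbb R_{++}$ is the set of positive reals. $\chi_X\in\{0,1\}^M$ is the characteristic vector of $X\subseteq M$, $\chi_j=\chi_{\{j\}}$, $\chi_0=\mathbf 0$; $\operatorname{supp}_+(x)=\{j:x_j>0\}$, $\operatorname{supp}_-(x)=\{j:x_j<0\}$. Each buyer $i$ has a valuation $v_i:[\mathbf 0,s]_{\mathbb Z}\to\mathbb R_+$ with $v_i(\mathbf 0)=0$, monotone ($x\le y\Rightarrow v_i(x)\le v_i(y)$), and $\mathrm M^\natural$-concave: for all $x,x'\in[\mathbf 0,s]_{\mathbb Z}$ and $j\in\operatorname{supp}_+(x-x')$ there is $k\in\operatorname{supp}_-(x-x')\cup\{0\}$ with $v_i(x)+v_i(x')\le v_i(x-\chi_j+\chi_k)+v_i(x'+\chi_j-\chi_k)$. For each $(i,j)\in N\times M$ there is a payment function $q_{ij}:\mathbb R_+\to\mathbb R_+$ that is continuous, piecewise-linear, strictly increasing, with $q_{ij}(0)=0$, and such that $q_{ij}(\kappa)=v_i(\chi_j)$ for some $\kappa\in\mathbb R_+$; $q'_{ij}$ is its right derivative. For $p\in\mathbb R_+^M$, the demand set of buyer $i$ is $D_i(p)=\arg\max_{x\in[\mathbf 0,s]_{\mathbb Z}}\{v_i(x)-\sum_{j\in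 M}q_{ij}(p_j)x_j\}$. **Equilibrium.** $p\in\mathbb R_+^M$ is an equilibrium price vector if there exist $x_i\in D_i(p)$ $(i\in N)$ with $\sum_{i\in N}x_i=s$. It is known that equilibrium price vectors exist in this model and that there is a unique (componentwise) minimum one, denoted $\underline p$. **Notation.** $\circ$ is the componentwise (Hadamard) product, $d_p^{-1}$ is the componentwise inverse of $d_p$, i.e. $(d_p^{-1})_j=1/(d_p)_j$, $\sum_{i\in N}D_i(p)$ is the Minkowski sum of the demand sets, $s-A=\{s-a:a\in A\}$, $d\circ A=\{d\circ a:a\in A\}$, and $\partial\tilde L(p)$ denotes the subdifferential of the convex function $\tilde L$ at $p$.
   Formalization: In (i) the sum of the demand sets is replaced by its convex hull (the printed equality is kept for the points of the subdifferential in d_p^{-1}∘Z^M), and the subdifferential is that of the formula for L̃ on all of R^M, which agrees with the one on R_+^M when p>0. *)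

(* Defs.v *)
From HB Require Import structures.
From mathcomp Require Import all_boot all_order all_algebra.
From mathcomp Require Import all_classical all_reals all_analysis.

Set Implicit Arguments.
Unset Strict Implicit.
Unset Printing Implicit Defensive.

Import Order.TTheory GRing.Theory Num.Theory.
Import numFieldNormedType.Exports.

Local Open Scope classical_set_scope.
Local Open Scope ring_scope.

Definition vle {R : numDomainType} {m : nat} (x y : 'rV[R]_m) : Prop :=
  forall j, x 0 j <= y 0 j.

Definition orthant {R : numDomainType} {m : nat} : set 'rV[R]_m :=
  [set x | vle 0 x].

Definition hadamard {R : pzSemiRingType} {m : nat} (x y : 'rV[R]_m) : 'rV[R]_m :=
  map2_mx *%R x y.

Definition vinv {R : unitRingType} {m : nat} (x : 'rV[R]_m) : 'rV[R]_m :=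
  map_mx GRing.inv x.

Definition dotr {R : pzSemiRingType} {m : nat} (x y : 'rV[R]_m) : R :=
  \sum_(j < m) x 0 j * y 0 j.

Definition of_int {R : pzRingType} {m : nat} (x : 'rV[int]_m) : 'rV[R]_m :=
  map_mx intr x.

Definition charv {R : pzSemiRingType} {m : nat} (X : {set 'I_m}) : 'rV[R]_m :=
  \row_j (j \in X)%:R.

(* [None] plays the role of the dummy good 0, with chi_0 = 0. *)
Definition chi {m : nat} (k : option 'I_m) : 'rV[int]_m :=
  if k is Some j then delta_mx 0 j else 0.

(* Total functions stand for functions on
    [0, s]_Z and on R_+; every condition is restricted to these domains. *)

Definition box {m : nat} (s : 'rV[int]_m) : set 'rV[int]_m :=
  [set x | vle 0 x /\ vle x s].

Definition supp_neg0 {m : nat} (z : 'rV[int]_m) : set (option 'I_m) :=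
  [set k | if k is Some j then z 0 j < 0 else True].

Definition Mnat_concave {R : realType} {m : nat} (s : 'rV[int]_m)
    (v : 'rV[int]_m -> R) : Prop :=
  forall x y, box s x -> box s y ->
  forall j, 0 < (x - y) 0 j ->
  exists2 k, supp_neg0 (x - y) k &
    v x + v y <= v (x - chi (Some j) + chi k) + v (y + chi (Some j) - chi k).

Definition valuation {R : realType} {m : nat} (s : 'rV[int]_m)
    (v : 'rV[int]_m -> R) : Prop :=
  [/\ forall x, box s x -> 0 <= v x,
      v 0 = 0,
      forall x y, box s x -> box s y -> vle x y -> v x <= v y
    & Mnat_concave s v].

(* Finitely many breakpoints: [f] is affine on every interval of R_+ whose
   interior contains no element of [t]. *)
Definition piecewise_linear {R : realType} (f : R -> R) : Prop :=
  exists t : seq R, forall a b : R, 0 <= a -> a <= b ->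
    (forall x, x \in t -> ~~ (a < x < b)) ->
    exists c e : R, forall x, a <= x <= b -> f x = c + e * x.

Definition payment {R : realType} (f : R -> R) : Prop :=
  [/\ forall x, 0 <= x -> 0 <= f x,
      {within [set x | 0 <= x], continuous f},
      piecewise_linear f,
      forall x y, 0 <= x -> x < y -> f x < f y
    & f 0 = 0].

Definition has_right_derivative {R : realType} (f : R -> R) (x l : R) : Prop :=
  (f (x + e) - f x) / e @[e --> 0^'+] --> l.

Definition utility {R : realType} {m : nat} (v : 'rV[int]_m -> R)
    (q : 'I_m -> R -> R) (p : 'rV[R]_m) (x : 'rV[int]_m) : R :=
  v x - \sum_(j < m) q j (p 0 j) * (x 0 j)%:~R.

Definition demand {R : realType} {m : nat} (s : 'rV[int]_m)
    (v : 'rV[int]_m -> R) (q : 'I_m -> R -> R) (p : 'rV[R]_m) :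
    set 'rV[int]_m :=
  [set x | box s x /\ forall y, box s y -> utility v q p y <= utility v q p x].

Definition minkowski_sum {V : nmodType} {n : nat} (A : 'I_n -> set V) : set V :=
  [set z | exists2 x : 'I_n -> V, forall i, A i (x i) & z = \sum_(i < n) x i].

Definition total_demand {R : realType} {m n : nat} (s : 'rV[int]_m)
    (v : 'I_n -> 'rV[int]_m -> R) (q : 'I_n -> 'I_m -> R -> R)
    (p : 'rV[R]_m) : set 'rV[int]_m :=
  minkowski_sum (fun i => demand s (v i) (q i) p).

Definition equilibrium {R : realType} {m n : nat} (s : 'rV[int]_m)
    (v : 'I_n -> 'rV[int]_m -> R) (q : 'I_n -> 'I_m -> R -> R)
    (p : 'rV[R]_m) : Prop :=
  vle 0 p /\ exists2 x : 'I_n -> 'rV[int]_m,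
    forall i, demand s (v i) (q i) p (x i) & \sum_(i < n) x i = s.

Definition min_equilibrium {R : realType} {m n : nat} (s : 'rV[int]_m)
    (v : 'I_n -> 'rV[int]_m -> R) (q : 'I_n -> 'I_m -> R -> R)
    (p : 'rV[R]_m) : Prop :=
  equilibrium s v q p /\ forall p', equilibrium s v q p' -> vle p p'.

(* The supremum ranges over a finite nonempty
    set, so it is a maximum; the formula makes sense for every real vector p,
    and coincides with the intended function on the nonnegative orthant. *)

Definition Vtilde {R : realType} {m : nat} (s : 'rV[int]_m)
    (v : 'rV[int]_m -> R) (a : R) (beta p : 'rV[R]_m) : R :=
  sup [set v x / a - \sum_(j < m) beta 0 j * p 0 j * (x 0 j)%:~R
      | x in box s].

Definition Ltilde {R : realType} {m n : nat} (s : 'rV[int]_m)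
    (v : 'I_n -> 'rV[int]_m -> R) (alpha : 'rV[R]_n) (beta p : 'rV[R]_m) : R :=
  \sum_(i < n) Vtilde s (v i) (alpha 0 i) beta p
  + \sum_(j < m) beta 0 j * p 0 j * (s 0 j)%:~R.

Definition direction {R : realType} {m : nat} (beta : 'rV[R]_m)
    (p : 'rV[R]_m) : 'rV[R]_m := \row_j (beta 0 j)^-1.

Definition polyhedron {R : realType} {m : nat} (C : set ('rV[R]_m * R)) : Prop :=
  exists (r : nat) (a : 'I_r -> 'rV[R]_m) (b c : 'I_r -> R),
    C = [set z | forall k, dotr (a k) z.1 + b k * z.2 <= c k].

Definition epigraph {R : realType} {m : nat} (D : set 'rV[R]_m)
    (f : 'rV[R]_m -> R) : set ('rV[R]_m * R) :=
  [set z | D z.1 /\ f z.1 <= z.2].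

Definition polyhedral_convex {R : realType} {m : nat} (D : set 'rV[R]_m)
    (f : 'rV[R]_m -> R) : Prop :=
  convex_function D f /\ polyhedron (epigraph D f).

(* The subdifferential at p of f regarded as +oo outside of D. *)
Definition subdifferential {R : realType} {m : nat} (D : set 'rV[R]_m)
    (f : 'rV[R]_m -> R) (p : 'rV[R]_m) : set 'rV[R]_m :=
  [set g | forall y, D y -> f p + dotr g (y - p) <= f y].

Definition convex_hull {R : realType} {m : nat} (A : set 'rV[R]_m) :
    set 'rV[R]_m :=
  smallest (fun B : set 'rV[R]_m => @convex_set R 'rV[R]_m B) A.

Definition diffquot {R : realType} {m : nat} (f : 'rV[R]_m -> R)
    (p u : 'rV[R]_m) (e : R) : R := (f (p + e *: u) - f p) / e.

Definition dirderiv {R : realType} {m : nat} (f : 'rV[R]_m -> R)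
    (p u : 'rV[R]_m) : R := lim (diffquot f p u e @[e --> 0^'+]).

(* Main.v *)
Require Import Defs.
From mathcomp Require Import all_boot all_order all_algebra.
From mathcomp Require Import all_classical all_reals all_analysis.
From mathcomp Require Import finmap zify ring lra.

(** The scaled Lyapunov function is the maximum, over all assignments of bundles
    to buyers, of affine functions whose gradients are [beta o (s - sum x_i)],
    and since every payment function is linear, [x_i] is optimal at [p] exactly
    when it is demanded at [p].  So the subdifferential is the convex hull of
    the gradients of the demanded assignments, by separation from a finite set.

    Its integral points come from the fact that a Minkowski sum of
    M-natural-convex sets has no holes.  For such a set D, the support function
    X |-> max_D w_X is submodular in X (a set of goods, possibly with the dummy
    good 0).  Given an integral h below the sum of the support functions, cut
    some D_i into [x_j <= c] and [x_j >= c + 1]; if h violated the bounds after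
    both cuts, uncrossing the two violated sets would contradict submodularity.
    Hence h survives one of the cuts, and one descends to singletons.

    For (ii), [pmin] minimizes the function globally, and the derivative at p in
    the direction [pmin - p >= 0] is a nonnegative combination of derivatives in
    directions chi_X, because a bundle of minimal cost for the weights
    [beta o (pmin - p)] in an M-natural-convex set also has minimal cardinality
    on every superlevel set of these weights.  Nonnegativity in the directions
    chi_X thus makes p a global minimizer. *)

Set Implicit Arguments.
Unset Strict Implicit.
Unset Printing Implicit Defensive.

Import Order.TTheory GRing.Theory Num.Theory.
Import numFieldNormedType.Exports.

Local Open Scope classical_set_scope.
Local Open Scope ring_scope.

(** * M-natural-convex sets of integer vectors *)

Definition Mnat_set {m : nat} (D : set 'rV[int]_m) : Prop :=
  forall x y, D x -> D y -> forall j, 0 < (x - y) 0 j ->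
  exists2 k, supp_neg0 (x - y) k &
    D (x - chi (Some j) + chi k) /\ D (y + chi (Some j) - chi k).

(* Good 0 has quantity [- sum_j x_j], so that adding a constant to w does not
   change the weight of x. *)
Definition wsum {R : pzRingType} {m : nat} (w : option 'I_m -> R)
    (x : 'rV[int]_m) : R :=
  \sum_(j < m) (w (Some j) - w None) * (x 0 j)%:~R.

Definition indw {m : nat} (X : {set option 'I_m}) (a : option 'I_m) : int :=
  (a \in X)%:R.

Definition maximizes {R : numDomainType} {m : nat} (D : set 'rV[int]_m)
    (w : option 'I_m -> R) (x : 'rV[int]_m) : Prop :=
  D x /\ forall y, D y -> wsum w y <= wsum w x.

Local Arguments chi : simpl never.

Lemma mxDE m (x y : 'rV[int]_m) i : (x + y) 0 i = x 0 i + y 0 i.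
Proof. by rewrite mxE. Qed.

Lemma mxNE m (x : 'rV[int]_m) i : (- x) 0 i = - x 0 i.
Proof. by rewrite mxE. Qed.

Definition addE := (mxDE, mxNE).

Lemma chiE m (k : option 'I_m) i : (chi k : 'rV[int]_m) 0 i = if k == Some i then 1 else 0.
Proof.
by case: k => [j|]; rewrite /chi mxE ?eqxx //= eq_sym; case: eqP => [->|/eqP];
  rewrite ?eqxx // => /negbTE; rewrite (inj_eq Some_inj) eq_sym => ->.
Qed.

Lemma wsumD (R : pzRingType) m (w : option 'I_m -> R) x y :
  wsum w (x + y) = wsum w x + wsum w y.
Proof.
by rewrite -big_split; apply: eq_bigr => j _; rewrite mxE intrD mulrDr.
Qed.

Lemma wsumN (R : pzRingType) m (w : option 'I_m -> R) x :
  wsum w (- x) = - wsum w x.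
Proof.
by rewrite -sumrN; apply: eq_bigr => j _; rewrite mxE intrN mulrN.
Qed.

Lemma wsumB (R : pzRingType) m (w : option 'I_m -> R) x y :
  wsum w (x - y) = wsum w x - wsum w y.
Proof. by rewrite wsumD wsumN. Qed.

(** For [None] both sides vanish, so exchanges with the dummy good need no separate treatment. *)
Lemma wsum_chi (R : pzRingType) m (w : option 'I_m -> R) k :
  wsum w (chi k) = w k - w None.
Proof.
rewrite /wsum; case: k => [j|].
  rewrite (bigD1 j) // chiE eqxx mulr1 big1 => [|i ij]; first exact: addr0.
  rewrite chiE; case: eqP => [[ji]|_]; last by rewrite mulr0.
  by rewrite ji eqxx in ij.
by rewrite big1 ?subrr // => i _; rewrite chiE mulr0.
Qed.

Lemma wsum_sum (R : pzRingType) m n (w : option 'I_m -> R)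
    (x : 'I_n -> 'rV[int]_m) :
  wsum w (\sum_i x i) = \sum_i wsum w (x i).
Proof.
elim/big_ind2: _ => // [|y a y' b <- <-]; last by rewrite wsumD.
by rewrite /wsum big1 // => j _; rewrite mxE mulr0.
Qed.

Lemma sum_gt0_ex (R : realDomainType) (I : finType) (F : I -> R) :
  0 < \sum_i F i -> exists i, 0 < F i.
Proof.
move=> F0; apply/not_existsP => N.
have : \sum_i F i <= 0.
  by apply: sumr_le0 => i _; rewrite leNgt; apply/negP/N.
by rewrite leNgt F0.
Qed.

(** * Exchanges and the l1 distance *)

Definition dist {m : nat} (x y : 'rV[int]_m) : nat :=
  \sum_(j < m) absz (x 0 j - y 0 j)%R.

Lemma distC m (x y : 'rV[int]_m) : dist x y = dist y x.
Proof. by apply: eq_bigr => j _; lia. Qed.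

(** The goods [j] and [k] each move one unit towards [y]; a dummy [k] moves nothing. *)
Lemma dist_exchange m (x y : 'rV[int]_m) j k :
  0 < (x - y) 0 j -> supp_neg0 (x - y) k ->
  (dist (x - chi (Some j) + chi k) y < dist x y)%N.
Proof.
move=> jP kP; rewrite /dist (bigD1 j) //= [X in (_ < X)%N](bigD1 j) //=.
rewrite -addSn leq_add //.
  move: jP kP; rewrite !(addE, chiE) eqxx.
  case: k => [k|]; rewrite /supp_neg0 /=; last by lia.
  rewrite !addE; case: eqP => [[->]|_]; lia.
apply: leq_sum => i ij; rewrite !(addE, chiE).
have -> : (Some j == Some i) = false.
  by apply/eqP => -[ji]; rewrite ji eqxx in ij.
case: k kP => [k|]; rewrite /supp_neg0 /= ?addE; last by lia.
case: eqP => [[->]|_]; lia.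
Qed.

(** The difference between the exchanged [x] and [y] is also that between [x] and the exchanged
    [y]. *)
Lemma dist_exchange' m (x y : 'rV[int]_m) j k :
  0 < (x - y) 0 j -> supp_neg0 (x - y) k ->
  (dist x (y + chi (Some j) - chi k) < dist x y)%N.
Proof.
move=> jP kP; have := dist_exchange jP kP; congr (_ < _)%N.
by apply: eq_bigr => i _; rewrite !addE; congr absz; lia.
Qed.

(* Among the counterexamples y take one nearest to x: exchanging between x and
   y keeps the value of y on X, by maximality of x, and brings it closer. *)
Lemma maximizes_level (R : realDomainType) m (D : set 'rV[int]_m)
    (w : option 'I_m -> R) x (X : {set option 'I_m}) :
  Mnat_set D -> maximizes D w x ->
  (forall a b, a \in X -> b \notin X -> w b < w a) ->
  maximizes D (indw X) x.
Proof.
move=> MD [Dx xmax] wX; split=> // y Dy.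
have [n] := ubnP (dist x y); elim: n y Dy => // n IH y Dy yn.
rewrite leNgt; apply/negP => xy; have := xy.
rewrite -subr_gt0 -wsumB => /sum_gt0_ex[j]; rewrite intz /indw.
have wmem a b : w a <= w b -> a \in X -> b \in X.
  by move=> wab aX; apply: contraLR wab => bX; rewrite -ltNge wX.
(* Relative to the dummy good, [j] has weight -1, 0 or 1; the sign decides whether the exchange
   starts from [x] or from [y]. *)
case: (boolP (None \in X)) (boolP (Some j \in X)) => [NX|NX] [jX|jX];
  rewrite ?subrr ?mul0r ?sub0r ?subr0 ?mulN1r ?mul1r //= => yx.
- have xyj : 0 < (x - y) 0 j by move: yx; rewrite !addE; lia.
  have [k kP [Dx' Dy']] := MD x y Dx Dy j xyj.
  have kX : k \notin X.
    apply: contra jX; apply: wmem.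
    have := xmax _ Dx'; rewrite wsumD wsumB !wsum_chi.
    by rewrite -addrA gerDl opprB addrC subrKA subr_le0.
  have := IH _ Dy' (leq_trans (dist_exchange' xyj kP) yn).
  rewrite wsumB wsumD !wsum_chi.
  have -> : indw X k = indw X (Some j) by rewrite /indw (negbTE jX) (negbTE kX).
  by rewrite addrK leNgt xy.
- have yxj : 0 < (y - x) 0 j by move: yx; rewrite !mxE; lia.
  have [k kP [Dy' Dx']] := MD y x Dy Dx j yxj.
  have kX : k \in X.
    apply: wmem jX.
    have := xmax _ Dx'; rewrite wsumB wsumD !wsum_chi.
    by rewrite -addrA gerDl opprB subrKA subr_le0.
  have := dist_exchange yxj kP; rewrite !(distC _ x) => yk.
  have := IH _ Dy' (leq_trans yk yn).
  rewrite wsumD wsumB !wsum_chi.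
  have -> : indw X k = indw X (Some j) by rewrite /indw jX kX.
  by rewrite subrK leNgt xy.
Qed.

(** * Maximizers and support functions *)

Lemma finite_argmax (T : choiceType) (R : realDomainType) (A : set T)
    (f : T -> R) : finite_set A -> A !=set0 ->
  exists2 x, A x & forall y, A y -> f y <= f x.
Proof.
move=> /finite_seqP[s ->]; elim: s => [[x]//|a [|b s] IH _].
  exists a; first by rewrite /= inE.
  by move=> y; rewrite /= inE => /eqP->.
have [|x xs xmax] := IH; first by exists b; rewrite /= inE eqxx.
have [fax|fxa] := leP (f a) (f x).
  exists x; first by rewrite /= inE xs orbT.
  by move=> y; rewrite /= inE => /orP[/eqP->//|]; exact: xmax.
exists a; first by rewrite /= inE eqxx.
move=> y; rewrite /= inE => /orP[/eqP->//|/xmax yx].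
exact: le_trans yx (ltW fxa).
Qed.

Lemma ex_maximizes (R : realDomainType) m (D : set 'rV[int]_m)
    (w : option 'I_m -> R) :
  finite_set D -> D !=set0 -> exists x, maximizes D w x.
Proof.
by move=> fD D0; have [x Dx xmax] := finite_argmax (wsum w) fD D0; exists x.
Qed.

(** The support function of [D] at the indicator of [X]; without a maximizer, [xget] falls back on
    the vector 0. *)
Definition maxw {m : nat} (D : set 'rV[int]_m) (X : {set option 'I_m}) : int :=
  wsum (indw X) (xget 0 [set x | maximizes D (indw X) x]).

Lemma maximizes_maxw m (D : set 'rV[int]_m) X x :
  maximizes D (indw X) x -> wsum (indw X) x = maxw D X.
Proof.
move=> xmax; rewrite /maxw; case: xgetP => [y _ ymax|/(_ x)//].
by apply/le_anti; rewrite (xmax.2 _ ymax.1) (ymax.2 _ xmax.1).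
Qed.

Lemma maxw_ge m (D : set 'rV[int]_m) X x :
  finite_set D -> D x -> wsum (indw X) x <= maxw D X.
Proof.
move=> fD Dx; have [|y ymax] := ex_maximizes (indw X) fD; first by exists x.
by rewrite -(maximizes_maxw ymax); exact: ymax.2.
Qed.

Lemma wsum_indwUI m (X Y : {set option 'I_m}) x :
  wsum (indw (X :|: Y)) x + wsum (indw (X :&: Y)) x =
  wsum (indw X) x + wsum (indw Y) x.
Proof.
rewrite -!big_split; apply: eq_bigr => j _ /=; rewrite -!mulrDl; congr (_ * _).
rewrite /indw !inE.
by do !case: (_ \in _).
Qed.

(** With the dummy good included, the quantities of [x] add up to 0, so those on [X] and on its
    complement are opposite. *)
Lemma wsum_indwC m (X : {set option 'I_m}) x :
  wsum (indw (~: X)) x = - wsum (indw X) x.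
Proof.
rewrite -sumrN; apply: eq_bigr => j _; rewrite -mulNr; congr (_ * _).
by rewrite /indw !inE; do !case: (_ \in _).
Qed.

Lemma wsum_indw1 m (j : 'I_m) x : wsum (indw [set Some j]) x = x 0 j.
Proof.
rewrite /wsum (bigD1 j) //= /indw !inE eqxx subr0 mul1r intz.
rewrite big1 ?addr0 // => i ij; rewrite !inE.
by case: eqP => [[ji]|_]; [rewrite ji eqxx in ij|rewrite subrr mul0r].
Qed.

Lemma wsum_indwD1 m (j : 'I_m) (X : {set option 'I_m}) x : Some j \in X ->
  wsum (indw X) x = wsum (indw (X :\ Some j)) x + x 0 j.
Proof.
move=> jX; rewrite -(wsum_indw1 j) [RHS]addrC -wsum_indwUI finset.setD1K //.
rewrite (_ : _ :&: _ = finset.set0) ?[wsum (indw finset.set0) x]big1 ?addr0 //.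
  by move=> i _; rewrite /indw !inE mul0r.
by apply/setP => a; rewrite !inE; case: eqP.
Qed.

(** Both sets are superlevel sets of the sum of their indicators, so one maximizer of this sum
    serves both. *)
Lemma maximizes_chain m (D : set 'rV[int]_m) (X Y : {set option 'I_m}) :
  Mnat_set D -> finite_set D -> D !=set0 -> X \subset Y ->
  exists2 x, maximizes D (indw X) x & maximizes D (indw Y) x.
Proof.
move=> MD fD D0 /fintype.subsetP XY.
pose w a := indw X a + indw Y a - (indw X None + indw Y None).
have [x xmax] := ex_maximizes w fD D0.
exists x; apply: (maximizes_level MD xmax) => a b aX bX;
  rewrite /w ltrD2r /indw aX (negbTE bX).
  by rewrite (XY _ aX); case: (b \in Y).
by rewrite (negbTE (contra (XY _) bX)); case: (a \in X).
Qed.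

(** At a common maximizer for the union and the intersection, modularity of the weights turns the
    left side into values on [X] and [Y]. *)
Lemma maxw_submodular m (D : set 'rV[int]_m) (X Y : {set option 'I_m}) :
  Mnat_set D -> finite_set D -> D !=set0 ->
  maxw D (X :|: Y) + maxw D (X :&: Y) <= maxw D X + maxw D Y.
Proof.
move=> MD fD D0; have XY : X :&: Y \subset X :|: Y.
  by apply/fintype.subsetP => a; rewrite !inE => /andP[->].
have [x xI xU] := maximizes_chain MD fD D0 XY.
rewrite -(maximizes_maxw xI) -(maximizes_maxw xU) wsum_indwUI.
by rewrite lerD ?maxw_ge //; case: xI.
Qed.

(** An exchange preserves the total weight of [x] and [y], so the new pair is again optimal, and
    [x 0 j] drops by exactly one. *)
Lemma maximizes_between m (D : set 'rV[int]_m) X x y j (c : int) :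
  Mnat_set D -> maximizes D (indw X) x -> maximizes D (indw X) y ->
  y 0 j <= c -> c <= x 0 j -> exists2 z, maximizes D (indw X) z & z 0 j = c.
Proof.
move=> MD xm ym yc.
have [n] := ubnP (absz (x 0 j - c)%R); elim: n x xm => // n IH x xm xn cx.
have [xc|xc] := eqVneq (x 0 j) c; first by exists x.
have xy : 0 < (x - y) 0 j.
  by rewrite !addE subr_gt0 (le_lt_trans yc) // lt_neqAle eq_sym xc.
have [k kP [Dx' Dy']] := MD x y xm.1 ym.1 j xy.
have x'j : (x - chi (Some j) + chi k) 0 j = x 0 j - 1.
  rewrite !(addE, chiE) eqxx.
  case: eqP => [kj|_]; last by rewrite addr0.
  by move: kP xy; rewrite kj /supp_neg0 /=; lia.
have xm' : maximizes D (indw X) (x - chi (Some j) + chi k).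
  split=> // z Dz; apply: le_trans (xm.2 _ Dz) _.
  have := ym.2 _ Dy'; rewrite !(wsumD, wsumN); lia.
by apply: (IH _ xm'); rewrite x'j; lia.
Qed.

(** * Cutting a set by a bound on one coordinate *)

(** If a maximizer on [X] survives the cut, nothing is lost. Otherwise maximizers on [X :\ Some j]
    lie on both sides of [c], and one lying exactly at [c] gives the second bound. *)
Lemma maxw_trunc_le m (D : set 'rV[int]_m) j (c : int) X :
  Mnat_set D -> finite_set D ->
  let D' := D `&` [set x | x 0 j <= c] in D' !=set0 ->
  maxw D X <= maxw D' X \/
  Some j \in X /\ maxw D (X :\ Some j) + c <= maxw D' X.
Proof.
move=> MD fD D' [x0 [Dx0 x0c]]; have D0 : D !=set0 by exists x0.
have fD' : finite_set D' by apply: sub_finite_set fD => x [].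
(* Maximizing on the complement of [j] is minimizing coordinate [j], so the nonempty cut contains
   all these maximizers. *)
have low x : maximizes D (indw (~: [set Some j])) x -> x 0 j <= c.
  case=> _ /(_ _ Dx0); rewrite !wsum_indwC !wsum_indw1 lerN2 => xx0.
  exact: le_trans xx0 x0c.
have [jX|jX] := boolP (Some j \in X); last first.
  left; have [|x xX /low xc] := @maximizes_chain m D X (~: [set Some j]) MD fD D0.
    by apply/fintype.subsetP => a aX; rewrite !inE; apply: contraNneq jX => <-.
  by rewrite -(maximizes_maxw xX) maxw_ge //; split=> //; case: xX.
have [x xX' xX] := maximizes_chain MD fD D0 (finset.subsetDl X [set Some j]).
have [xc|cx] := leP (x 0 j) c.
  by left; rewrite -(maximizes_maxw xX) maxw_ge //; split=> //; case: xX.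
right; split=> //.
have [|y yX' /low yc] :=
    @maximizes_chain m D (X :\ Some j) (~: [set Some j]) MD fD D0.
  by apply/fintype.subsetP => a; rewrite !inE => /andP[].
have [z zX' zc] := maximizes_between MD xX' yX' yc (ltW cx).
rewrite -(maximizes_maxw zX') -{1}zc -wsum_indwD1 // maxw_ge //.
by split; [case: zX'|rewrite /= zc].
Qed.

(** Reflection turns lower cuts into upper cuts and [X] into its complement, which reduces
    [maxw_trunc_ge] to [maxw_trunc_le]. *)
Definition oppset {m : nat} (D : set 'rV[int]_m) : set 'rV[int]_m :=
  [set x | D (- x)].

Lemma Mnat_oppset m (D : set 'rV[int]_m) : Mnat_set D -> Mnat_set (oppset D).
Proof.
move=> MD x y Dx Dy j xy.
have e : - y - - x = x - y by rewrite opprK addrC.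
have [|k kP [Dy' Dx']] := MD (- y) (- x) Dy Dx j; first by rewrite e.
exists k; first by rewrite -e.
by split; rewrite /oppset /= !opprD !opprK.
Qed.

Lemma finite_oppset m (D : set 'rV[int]_m) :
  finite_set D -> finite_set (oppset D).
Proof.
move=> fD; apply: (sub_finite_set _ (finite_image -%R fD)) => x Dx.
by exists (- x) => //; rewrite opprK.
Qed.

Lemma maxw_oppset m (D : set 'rV[int]_m) X :
  finite_set D -> D !=set0 -> maxw (oppset D) X = maxw D (~: X).
Proof.
move=> fD D0; have [x [Dx xmax]] := ex_maximizes (indw (~: X)) fD D0.
rewrite -(@maximizes_maxw _ D (~: X) x) //.
rewrite -(@maximizes_maxw _ (oppset D) X (- x)).
  by rewrite wsum_indwC wsumN.
split=> [|y Dy]; first by rewrite /oppset /= opprK.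
by have := xmax _ Dy; rewrite !wsum_indwC !wsumN opprK.
Qed.

Lemma maxw_trunc_ge m (D : set 'rV[int]_m) j (c : int) X :
  Mnat_set D -> finite_set D ->
  let D' := D `&` [set x | c <= x 0 j] in D' !=set0 ->
  maxw D X <= maxw D' X \/
  Some j \notin X /\ maxw D (Some j |: X) - c <= maxw D' X.
Proof.
move=> MD fD D' D'0; have fD' : finite_set D' by apply: sub_finite_set fD => x [].
have D0 : D !=set0 by case: D'0 => x [Dx _]; exists x.
have e : oppset D `&` [set x | x 0 j <= - c] = oppset D'.
  by apply/seteqP; split=> x; rewrite /D' /oppset /= addE lerNr.
have := @maxw_trunc_le m (oppset D) j (- c) (~: X) (Mnat_oppset MD)
  (finite_oppset fD).
rewrite /= e !maxw_oppset // !finset.setCK => -[|->|[]].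
- by case: D'0 => x; exists (- x); rewrite /oppset /= opprK.
- by left.
by rewrite inE finset.setCD finset.setCK finset.setUC => jX jc; right.
Qed.

(** Coordinates of the exchanged vectors stay between those of [x] and [y], so bounds persist; this
    serves the cuts and the box alike. *)
Lemma exchange_le m (x y : 'rV[int]_m) j k l c :
  0 < (x - y) 0 j -> supp_neg0 (x - y) k -> x 0 l <= c -> y 0 l <= c ->
  (x - chi (Some j) + chi k) 0 l <= c /\ (y + chi (Some j) - chi k) 0 l <= c.
Proof.
move=> jP kP xl yl; rewrite !(addE, chiE).
move: jP; rewrite addE; case: k kP => [k|]; rewrite /supp_neg0 /= ?addE.
  by case: eqP => [[->]|_]; case: eqP => [[->]|_]; lia.
by case: eqP => [[->]|_]; lia.
Qed.

Lemma exchange_ge m (x y : 'rV[int]_m) j k l c :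
  0 < (x - y) 0 j -> supp_neg0 (x - y) k -> c <= x 0 l -> c <= y 0 l ->
  c <= (x - chi (Some j) + chi k) 0 l /\ c <= (y + chi (Some j) - chi k) 0 l.
Proof.
move=> jP kP xl yl; rewrite !(addE, chiE).
move: jP; rewrite addE; case: k kP => [k|]; rewrite /supp_neg0 /= ?addE.
  by case: eqP => [[->]|_]; case: eqP => [[->]|_]; lia.
by case: eqP => [[->]|_]; lia.
Qed.

Lemma Mnat_le m (D : set 'rV[int]_m) l c :
  Mnat_set D -> Mnat_set (D `&` [set z | z 0 l <= c]).
Proof.
move=> MD x y [Dx xc] [Dy yc] j xy; have [k kP [Dx' Dy']] := MD x y Dx Dy j xy.
by exists k => //; have [] := exchange_le xy kP xc yc.
Qed.

Lemma Mnat_ge m (D : set 'rV[int]_m) l c :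
  Mnat_set D -> Mnat_set (D `&` [set z | c <= z 0 l]).
Proof.
move=> MD x y [Dx xc] [Dy yc] j xy; have [k kP [Dx' Dy']] := MD x y Dx Dy j xy.
by exists k => //; have [] := exchange_ge xy kP xc yc.
Qed.

(** * Integral points of Minkowski sums *)

Lemma minkowski_integral m n (D : 'I_n -> set 'rV[int]_m) h :
  (forall i, Mnat_set (D i)) -> (forall i, finite_set (D i)) ->
  (forall i, D i !=set0) ->
  (forall X, wsum (indw X) h <= \sum_i maxw (D i) X) ->
  minkowski_sum D h.
Proof.
have [N] := ubnP (\sum_i #|` fset_set (D i)|)%N.
elim: N D => // N IH D DN MD fD D0 hD.
have [[i [x [y [j [Dx Dy xy]]]]]|single] := pselect (exists i x y j,
    [/\ D i x, D i y & x 0 j < y 0 j]); last first.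
  exists (fun i => xget 0 (D i)) => [i|].
    exact: (xgetPex 0 (D0 i)).
  have val i X : maxw (D i) X = wsum (indw X) (xget 0 (D i)).
    have [x xmax] := ex_maximizes (indw X) (fD i) (D0 i).
    rewrite -(maximizes_maxw xmax); congr wsum.
    apply/rowP => j; have Dx := xgetPex 0 (D0 i).
    by case: (ltgtP (x 0 j) (xget 0 (D i) 0 j)) => // lt; case: single;
      [exists i, x, (xget 0 (D i)), j|exists i, (xget 0 (D i)), x, j];
      split=> //; case: xmax.
  have sumE X : \sum_i maxw (D i) X = wsum (indw X) (\sum_i xget 0 (D i)).
    by rewrite wsum_sum; apply: eq_bigr => i _; exact: val.
  (* The bounds for the set of [j] alone and for its complement are opposite bounds on coordinate
     [j]. *)
  apply/rowP => j; apply/le_anti/andP; split.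
    by rewrite -!wsum_indw1 -sumE.
  by rewrite -lerN2 -!wsum_indw1 -!wsum_indwC -sumE.
(* Only the lower cut keeps [x] and only the upper cut keeps [y], so both are strictly smaller than
   [D i]. *)
pose c := x 0 j.
pose D1 k := if k == i then D k `&` [set z | z 0 j <= c] else D k.
pose D2 k := if k == i then D k `&` [set z | c + 1 <= z 0 j] else D k.
have smaller (E : 'I_n -> set 'rV[int]_m) P u : E i = D i `&` P ->
    (forall k, k != i -> E k = D k) -> D i u -> ~ P u ->
    (\sum_i #|` fset_set (E i)| < N)%N.
  move=> Ei Ek Du Pu; apply: leq_trans (ltnSE DN).
  rewrite (bigD1 i) //= [X in (_ < X)%N](bigD1 i) //= -addSn leq_add //.
    have fE : finite_set (E i) by rewrite Ei; apply: sub_finite_set (fD i) => z [].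
    apply: fproper_ltn_card; rewrite fproperE; apply/andP; split.
      by apply/fsubsetP => z; rewrite !in_fset_set // Ei !in_setE => -[].
    apply/negP => /fsubsetP/(_ u); rewrite !in_fset_set // Ei !in_setE.
    by move=> /(_ Du)[].
  by apply: leq_sum => k /Ek->.
have MD1 k : Mnat_set (D1 k) by rewrite /D1; case: eqP => _ //; exact: Mnat_le.
have MD2 k : Mnat_set (D2 k) by rewrite /D2; case: eqP => _ //; exact: Mnat_ge.
have fD1 k : finite_set (D1 k).
  by rewrite /D1; case: eqP => _ //; apply: sub_finite_set (fD k) => z [].
have fD2 k : finite_set (D2 k).
  by rewrite /D2; case: eqP => _ //; apply: sub_finite_set (fD k) => z [].
have D10 k : D1 k !=set0.
  by rewrite /D1; case: eqP => [->|//]; exists x; split=> //=; rewrite /c.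
have D20 k : D2 k !=set0.
  rewrite /D2; case: eqP => [->|//]; exists y; split=> //=.
  by rewrite /c; lia.
have D1D k : D1 k `<=` D k by rewrite /D1; case: eqP => _ z //; case.
have D2D k : D2 k `<=` D k by rewrite /D2; case: eqP => _ z //; case.
have liftD (E : 'I_n -> set 'rV[int]_m) :
    (forall k, E k `<=` D k) -> minkowski_sum E h -> minkowski_sum D h.
  by move=> ED [z Ez ->]; exists z => // k; exact: ED.
have D1i : D1 i = D i `&` [set z | z 0 j <= c] by rewrite /D1 eqxx.
have D2i : D2 i = D i `&` [set z | c + 1 <= z 0 j] by rewrite /D2 eqxx.
have D1k k : k != i -> D1 k = D k by rewrite /D1 => /negbTE->.
have D2k k : k != i -> D2 k = D k by rewrite /D2 => /negbTE->.
have [hD1|/existsNP[X /negP hX]] :=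
    pselect (forall X, wsum (indw X) h <= \sum_k maxw (D1 k) X).
  apply: (liftD D1) => //; apply: IH => //.
  by apply: (smaller D1 [set z | z 0 j <= c] y) => //=; rewrite /c; lia.
have [hD2|/existsNP[Y /negP hY]] :=
    pselect (forall X, wsum (indw X) h <= \sum_k maxw (D2 k) X).
  apply: (liftD D2) => //; apply: IH => //.
  by apply: (smaller D2 [set z | c + 1 <= z 0 j] x) => //=; rewrite /c; lia.
exfalso; move: hX hY.
pose S Z := \sum_(k < n | k != i) maxw (D k) Z.
have SD Z : \sum_k maxw (D k) Z = maxw (D i) Z + S Z by rewrite (bigD1 i).
rewrite -!ltNge (bigD1 i) //= [X in _ -> X < _ -> _](bigD1 i) //=.
rewrite (eq_bigr (fun k => maxw (D k) X)) => [|k /D1k-> //].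
rewrite [X in _ -> _ + X < _ -> _](eq_bigr (fun k => maxw (D k) Y))
  => [|k /D2k-> //].
rewrite -/(S X) -/(S Y) => hX hY.
have SUI : S (X :|: Y) + S (X :&: Y) <= S X + S Y.
  by rewrite -!big_split; apply: ler_sum => k _; exact: maxw_submodular.
have := hD X; have := hD Y; have := hD (X :|: Y); have := hD (X :&: Y).
rewrite !SD; have := wsum_indwUI X Y h => UI hI hU hYD hXD.
have := @maxw_trunc_le _ (D i) j c X (MD i) (fD i).
rewrite /= -D1i => /(_ (D10 i))[|[jX]]; first by lia.
have := @maxw_trunc_ge _ (D i) j (c + 1) Y (MD i) (fD i).
rewrite /= -D2i => /(_ (D20 i))[|[jY]]; first by lia.
(* The two violated integer bounds contribute at least 2, while passing from [c] to [c + 1] costs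
   only 1: submodularity fails. *)
have := maxw_submodular (X :\ Some j) (Some j |: Y) (MD i) (fD i) (D0 i).
have -> : (X :\ Some j) :|: (Some j |: Y) = X :|: Y.
  by apply/setP => a; rewrite !inE; case: eqP => [->|_] //=; rewrite jX.
have -> : (X :\ Some j) :&: (Some j |: Y) = X :&: Y.
  apply/setP => a; rewrite !inE; case: eqP => [->|_] //=.
  by rewrite (negbTE jY) andbF.
lia.
Qed.

(** * Convex hulls of finite sets *)

Lemma convex_setP (R : numDomainType) (V : lmodType R) (B : set V) :
  @convex_set R V B <-> forall (t : R) x y, 0 <= t <= 1 -> B x -> B y ->
    B (t *: x + (1 - t) *: y).
Proof.
split=> [cB t x y /andP[t0 t1] Bx By|cB x y t /set_mem Bx /set_mem By].
  have := cB x y (Itv01 t0 t1); rewrite !in_setE; exact.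
rewrite in_setE; apply: (cB (t%:num)%R) => //.
by apply/andP; split.
Qed.

Lemma convex_set_sum (R : numFieldType) (V : lmodType R) (B : set V) n
    (t : 'I_n -> R) (z : 'I_n -> V) :
  @convex_set R V B -> (forall k, 0 <= t k) -> \sum_k t k = 1 ->
  (forall k, B (z k)) -> B (\sum_k t k *: z k).
Proof.
move=> /convex_setP cB; elim: n t z => [|n IH] t z t0.
  by rewrite big_ord0 => /esym/eqP; rewrite oner_eq0.
rewrite !big_ord_recl => t1 Bz.
set r := \sum_(i < n) t (lift ord0 i) in t1.
have r0 : 0 <= r by apply: sumr_ge0.
have tr : t ord0 = 1 - r by rewrite -t1 addrK.
(* If the remaining weights sum to 0, they all vanish and cannot be normalized. *)
have [r_eq0|r_neq0] := eqVneq r 0.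
  rewrite tr r_eq0 subr0 scale1r big1 ?addr0 // => i _.
  have /eqP := r_eq0; rewrite psumr_eq0 // => /allP/(_ i).
  by rewrite mem_index_enum => /(_ isT)/eqP->; rewrite scale0r.
have := IH (fun i => r^-1 * t (lift ord0 i)) (fun i => z (lift ord0 i)).
rewrite -mulr_sumr mulVf // => /(_ _ erefl) Brest.
have -> : t ord0 *: z ord0 + \sum_(i < n) t (lift ord0 i) *: z (lift ord0 i) =
    t ord0 *: z ord0 + (1 - t ord0) *:
      \sum_(i < n) (r^-1 * t (lift ord0 i)) *: z (lift ord0 i).
  have -> : 1 - t ord0 = r by rewrite tr opprB addrC subrK.
  congr (_ + _); rewrite scaler_sumr.
  by apply: eq_bigr => i _; rewrite scalerA mulrA mulfV // mul1r.
apply: cB => //.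
  by rewrite t0 /= tr gerBl.
by apply: Brest => // i; rewrite mulr_ge0 // invr_ge0.
Qed.

Definition simplex (R : numDomainType) n : set 'rV[R]_n :=
  [set t | (forall k, 0 <= t 0 k) /\ \sum_k t 0 k = 1].

Lemma sum_coord_continuous (R : realType) n (I : finType) (F : I -> 'rV[R]_n -> R) :
  (forall i, continuous (F i)) -> continuous (fun t => \sum_i F i t).
Proof. by move=> cF; apply: continuous_big => [|i _]; [exact: add_continuous|exact: cF]. Qed.

(** The simplex is cut out of the compact unit cube by closed conditions. *)
Lemma simplex_compact (R : realType) n : compact (@simplex R n).
Proof.
have cb : compact [set t : 'rV[R]_n | forall k, [set` `[0, 1]] (t ord0 k)].
  by apply: (@rV_compact R n (fun=> [set` `[0, 1]])) => i; exact: segment_compact.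
apply: subclosed_compact cb _.
  have -> : @simplex R n = \bigcap_k [set t : 'rV[R]_n | 0 <= t 0 k] `&`
      (fun t : 'rV[R]_n => \sum_k t 0 k) @^-1` [set 1].
    by apply/seteqP; split=> t [t0 t1]; split=> // k; [move=> _|]; exact: t0.
  apply: closedI.
    apply: closed_bigI => k _.
    apply: (@preimage_closed _ _ (fun t : 'rV[R]_n => t 0 k) [set x | 0 <= x]).
      by move=> t _; exact: coord_continuous.
    exact: closed_ge.
  apply: preimage_closed; last exact: closed_eq.
  by move=> t _; apply: sum_coord_continuous => k; exact: coord_continuous.
move=> t [t0 t1] k /=; rewrite in_itv /= t0 /= -t1 (bigD1 k) //= lerDl.
by apply: sumr_ge0.
Qed.

(** * Inner products and nearest points *)

Lemma dotrC (R : comPzRingType) m (x y : 'rV[R]_m) : dotr x y = dotr y x.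
Proof. by apply: eq_bigr => j _; rewrite mulrC. Qed.

Lemma dotrDl (R : pzRingType) m (x y z : 'rV[R]_m) :
  dotr (x + y) z = dotr x z + dotr y z.
Proof. by rewrite -big_split; apply: eq_bigr => j _; rewrite mxE mulrDl. Qed.

Lemma dotrDr (R : pzRingType) m (x y z : 'rV[R]_m) :
  dotr z (x + y) = dotr z x + dotr z y.
Proof. by rewrite -big_split; apply: eq_bigr => j _; rewrite mxE mulrDr. Qed.

Lemma dotrZl (R : pzRingType) m (a : R) (x y : 'rV[R]_m) :
  dotr (a *: x) y = a * dotr x y.
Proof. by rewrite /dotr mulr_sumr; apply: eq_bigr => j _; rewrite mxE mulrA. Qed.

Lemma dotrZr (R : comPzRingType) m (a : R) (x y : 'rV[R]_m) :
  dotr x (a *: y) = a * dotr x y.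
Proof. by rewrite dotrC dotrZl dotrC. Qed.

Lemma dotrBr (R : pzRingType) m (x y z : 'rV[R]_m) :
  dotr z (x - y) = dotr z x - dotr z y.
Proof.
by rewrite -sumrB; apply: eq_bigr => j _; rewrite !mxE mulrBr.
Qed.

Lemma dotr_ge0 (R : realDomainType) m (x : 'rV[R]_m) : 0 <= dotr x x.
Proof. by apply: sumr_ge0 => j _; rewrite -expr2 sqr_ge0. Qed.

Lemma dotr_eq0 (R : realDomainType) m (x : 'rV[R]_m) :
  dotr x x <= 0 -> x = 0.
Proof.
move=> x0; have /eqP : dotr x x = 0 by apply/le_anti; rewrite x0 dotr_ge0.
rewrite psumr_eq0 => [/allP h|j _]; last by rewrite -expr2 sqr_ge0.
apply/rowP => j; rewrite mxE; apply/eqP; rewrite -sqrf_eq0 expr2.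
by apply: (h j); rewrite mem_index_enum.
Qed.

Lemma dotr_ge0_min (R : realFieldType) m (x y : 'rV[R]_m) :
  (forall e : R, 0 <= e <= 1 ->
     dotr x x <= dotr (x + e *: y) (x + e *: y)) -> 0 <= dotr x y.
Proof.
move=> xmin; rewrite leNgt; apply/negP => xy.
have y0 := dotr_ge0 y; set d := dotr y y - dotr x y.
have d0 : 0 < d by rewrite subr_gt0 (lt_le_trans xy).
(* This step changes the squared norm by [e * (1 + e) * dotr x y < 0]; the summand [- dotr x y] in
   [d] ensures [0 < d] and [e <= 1]. *)
set e := - dotr x y / d.
have eE : e * d = - dotr x y by rewrite divfK ?gt_eqF.
have e0 : 0 < e by rewrite divr_gt0 ?oppr_gt0.
have e01 : 0 <= e <= 1.
  by rewrite ltW //= ler_pdivrMr // mul1r lerDr.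
have := xmin e e01; rewrite !(dotrDl, dotrDr, dotrZl, dotrZr) (dotrC y).
move: eE e0 xy y0; rewrite /d; move: (dotr x y) (dotr y y) (dotr x x) => a b c.
clearbody e; clear; nra.
Qed.

(* The point c of the convex hull of A nearest to h satisfies
   <c - h, z - c> >= 0 for all z in A; the hypothesis applied to w = c - h
   then forces c = h. *)
Lemma convex_hull_finite_sep (R : realType) m (A : set 'rV[R]_m) h :
  finite_set A -> (forall w, exists2 z, A z & dotr w z <= dotr w h) ->
  convex_hull A h.
Proof.
move=> /finite_seqP[s As]; rewrite {}As => sep.
pose z (k : 'I_(size s)) := tnth (in_tuple s) k.
pose c (t : 'rV[R]_(size s)) := \sum_k t 0 k *: z k - h.
have cE t j : c t 0 j = \sum_k t 0 k * z k 0 j - h 0 j.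
  rewrite /c !mxE summxE; congr (_ - _).
  by apply: eq_bigr => k _; rewrite mxE.
have coordC k : continuous (fun t : 'rV[R]_(size s) => t 0 k).
  exact: coord_continuous.
have cC j : continuous (fun t => c t 0 j).
  have -> : (fun t => c t 0 j) = (fun t => \sum_k t 0 k * z k 0 j - h 0 j).
    by apply/funext => t; rewrite cE.
  move=> t; apply: continuousB; last exact: cst_continuous.
  apply: sum_coord_continuous => k {}t.
  by apply: continuousM; [exact: coordC|exact: cst_continuous].
have fC : continuous (fun t => dotr (c t) (c t)).
  by apply: sum_coord_continuous => j t; apply: continuousM; exact: cC.
have simplex0 : @simplex R (size s) !=set0.
  have s0 : (0 < size s)%N by have [x /= xs _] := sep 0; case: (s) xs.
  exists (delta_mx 0 (Ordinal s0)); split=> [k|]; first by rewrite mxE ler0n.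
  rewrite (bigD1 (Ordinal s0)) //= mxE !eqxx big1 ?addr0 // => k /negbTE k0.
  by rewrite mxE k0 andbF.
(* The hull is parametrized by the compact simplex, on which the squared distance to [h] attains its
   minimum. *)
have [t + tmin] := EVT_min_rV simplex0 (simplex_compact (n:=_))
  (continuous_subspaceT fC).
rewrite in_setE => -[t0 t1].
have var k (e : R) : 0 <= e <= 1 ->
    dotr (c t) (c t) <=
    dotr (c t + e *: (z k - h - c t)) (c t + e *: (z k - h - c t)).
  (* Moving towards [z k] means shifting a fraction [e] of the weights [t] to the index [k]. *)
  move=> /andP[e0 e1]; pose u := t + e *: (delta_mx 0 k - t).
  have uE i : u 0 i = (1 - e) * t 0 i + e * (i == k)%:R.
    by rewrite /u !mxE eqxx /=; ring.
  have sumE F : \sum_i u 0 i * F i = (1 - e) * (\sum_i t 0 i * F i) + e * F k.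
    rewrite (eq_bigr _ (fun i _ => congr1 (fun a => a * F i) (uE i))).
    under eq_bigr => i _ do rewrite mulrDl -!mulrA.
    rewrite big_split /= -!mulr_sumr; congr (_ + e * _).
    rewrite (bigD1 k) //= eqxx mul1r big1 ?addr0 // => i /negbTE ->.
    by rewrite mul0r.
  have -> : c t + e *: (z k - h - c t) = c u.
    have lin (x y : 'rV[R]_m) j :
        (x + e *: (y - h - x)) 0 j = x 0 j + e * (y 0 j - h 0 j - x 0 j).
      by rewrite !mxE.
    by apply/rowP => j; rewrite lin !cE sumE; ring.
  apply: tmin; rewrite in_setE; split=> [i|].
    by rewrite uE addr_ge0 ?mulr_ge0 ?subr_ge0 ?ler0n.
  have sum1 (w : 'rV[R]_(size s)) : \sum_i w 0 i * 1 = \sum_i w 0 i.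
    by apply: eq_bigr => i _; rewrite mulr1.
  by have := sumE (fun=> 1); rewrite !sum1 t1 !mulr1 subrK.
have ge0 k : 0 <= dotr (c t) (z k - h - c t) by apply: dotr_ge0_min (var k).
have [x /= xs ch] := sep (c t); have [k xk] : exists k, x = z k by exact/(tnthP (in_tuple s)).
rewrite xk in ch.
have := ge0 k; rewrite (dotrBr (z k - h)) (dotrBr (z k)) subr_ge0 => ck.
have /dotr_eq0/eqP : dotr (c t) (c t) <= 0.
  by apply: le_trans ck _; rewrite subr_le0.
rewrite subr_eq0 => /eqP <- B [cB sB]; apply: convex_set_sum => // i.
by apply: sB; exact: mem_tnth.
Qed.

(** * Linear payments *)

Lemma affine_right_derivative (R : realType) (f : R -> R) a b c d e :
  a < b -> (forall x, a <= x <= b -> f x = d + e * x) ->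
  has_right_derivative f a c -> e = c.
Proof.
move=> ab fE fc; apply: (cvg_unique _ _ fc) => //; apply: cvg_near_cst.
near=> h; have h0 : 0 < h by near: h; exact: nbhs_right_gt.
have hb : h < b - a by near: h; apply: nbhs_right_lt; rewrite subr_gt0.
rewrite !fE ?lexx ?(ltW ab) //; last by lra.
by field; rewrite gt_eqF.
Unshelve. all: by end_near. Qed.

Lemma count_ltn (T : eqType) (P Q : pred T) (s : seq T) x :
  subpred P Q -> x \in s -> ~~ P x -> Q x -> (count P s < count Q s)%N.
Proof.
move=> PQ + Px Qx; elim: s => //= y s IH; rewrite inE.
move=> /predU1P[<-|/IH lt]; last by have := PQ y; case: (P y); case: (Q y); lia.
by rewrite (negbTE Px) Qx add0n add1n ltnS sub_count.
Qed.

(** Induction on the number of breakpoints strictly between [a] and [b]. Without any, [f] is affine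
    with slope read off at [a]; otherwise a breakpoint splits the interval and is interior to
    neither half. *)
Lemma piecewise_linear_const_derivative (R : realType) (f : R -> R) c :
  piecewise_linear f -> (forall x, 0 <= x -> has_right_derivative f x c) ->
  forall a b, 0 <= a -> a <= b -> f b - f a = c * (b - a).
Proof.
move=> [t ft] fc a b; have [n] := ubnP (count [pred x | a < x < b] t).
elim: n a b => // n IH a b tn a0; rewrite le_eqVlt => /predU1P[->|ab].
  by rewrite !subrr mulr0.
have [/hasP[x xt /andP[ax xb]]|/hasPn none] := boolP (has [pred x | a < x < b] t);
  last first.
  have [d [e fE]] := ft a b a0 (ltW ab) none.
  rewrite -(affine_right_derivative ab fE (fc a a0)) !fE ?lexx ?(ltW ab) //.
  by ring.
have ltc y z : a <= y -> z <= b -> ~~ (y < x < z) ->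
    (count [pred w | y < w < z]%R t < n)%N.
  move=> ay zb yxz; apply: leq_trans (ltnSE tn).
  apply: (@count_ltn _ _ _ _ x) => //=; last by rewrite ax xb.
  by move=> w /andP[yw wz]; rewrite /= (le_lt_trans ay yw) (lt_le_trans wz zb).
have -> : f b - f a = (f x - f a) + (f b - f x) by ring.
rewrite (IH a x) ?(IH x b) ?(ltW ax) ?(ltW xb) ?(le_trans a0 (ltW ax)) //.
- by ring.
- by apply: ltc; rewrite ?lexx ?(ltW ax) // ltxx.
by apply: ltc; rewrite ?lexx ?(ltW xb) // ltxx andbF.
Qed.

Lemma payment_linear (R : realType) (f : R -> R) c : payment f ->
  (forall x, 0 <= x -> has_right_derivative f x c) ->
  forall x, 0 <= x -> f x = c * x.
Proof.
move=> [_ _ fp _ f0] fc x x0.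
by have := piecewise_linear_const_derivative fp fc (lexx 0) x0; rewrite f0 !subr0.
Qed.

(** * Componentwise products and integer bundles *)

Lemma hadamardE (R : pzSemiRingType) m (x y : 'rV[R]_m) j :
  hadamard x y 0 j = x 0 j * y 0 j.
Proof. by rewrite mxE. Qed.

Lemma of_intE (R : pzRingType) m (x : 'rV[int]_m) j :
  (of_int x : 'rV[R]_m) 0 j = (x 0 j)%:~R.
Proof. by rewrite mxE. Qed.

Lemma of_intB (R : pzRingType) m (x y : 'rV[int]_m) :
  of_int (x - y) = of_int x - of_int y :> 'rV[R]_m.
Proof. by apply/rowP => j; rewrite !mxE intrB. Qed.

Lemma of_int_sum (R : pzRingType) m n (x : 'I_n -> 'rV[int]_m) :
  of_int (\sum_i x i) = \sum_i of_int (x i) :> 'rV[R]_m.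
Proof.
apply/rowP => j; rewrite of_intE !summxE rmorph_sum.
by apply: eq_bigr => i _; rewrite of_intE.
Qed.

Lemma dotr_hadamardA (R : comPzRingType) m (x y z : 'rV[R]_m) :
  dotr (hadamard x y) z = dotr y (hadamard x z).
Proof. by apply: eq_bigr => j _; rewrite !hadamardE mulrCA mulrA. Qed.

Lemma dotr_sumr (R : pzRingType) m n (x : 'rV[R]_m) (y : 'I_n -> 'rV[R]_m) :
  dotr x (\sum_i y i) = \sum_i dotr x (y i).
Proof.
rewrite /dotr exchange_big; apply: eq_bigr => j _.
by rewrite summxE mulr_sumr.
Qed.

Lemma box_finite m (s : 'rV[int]_m) : finite_set (box s).
Proof.
pose N := (\sum_j absz (s 0%R j)).+1.
pose f (a : {ffun 'I_m -> 'I_N}) : 'rV[int]_m := \row_j (a j : nat)%:Z.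
apply: (@sub_finite_set _ _ (f @` setT)); last first.
  by apply: finite_image; exact: finite_finset.
move=> x [x0 xs]; exists [ffun j => inord (absz (x 0 j))] => //.
have x0j j : 0 <= x 0 j by have := x0 j; rewrite mxE.
apply/rowP => j; rewrite mxE ffunE inordK ?gez0_abs // ltnS (bigD1 j) //=.
by apply: leq_trans (leq_addr _ _); rewrite -lez_nat !gez0_abs ?(le_trans _ (xs j)).
Qed.

(** * Demand in scaled prices *)

Definition sutility {R : realType} {m : nat} (v : 'rV[int]_m -> R) (a : R)
    (beta p : 'rV[R]_m) (x : 'rV[int]_m) : R :=
  v x / a - dotr (hadamard beta p) (of_int x).

Definition sdemand {R : realType} {m : nat} (s : 'rV[int]_m)
    (v : 'rV[int]_m -> R) (a : R) (beta p : 'rV[R]_m) : set 'rV[int]_m :=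
  [set x | box s x /\
    forall y, box s y -> sutility v a beta p y <= sutility v a beta p x].

(** With linear payments, utility is the positive constant [a] times scaled utility, so the
    maximizers agree. *)
Lemma demandE (R : realType) m (s : 'rV[int]_m) (v : 'rV[int]_m -> R)
    (q : 'I_m -> R -> R) a (beta p : 'rV[R]_m) :
  0 < a -> (forall j x, 0 <= x -> q j x = a * beta 0 j * x) -> orthant p ->
  demand s v q p = sdemand s v a beta p.
Proof.
move=> a0 qE p0.
have uE x : utility v q p x = a * sutility v a beta p x.
  rewrite /utility /sutility mulrBr mulrCA mulfV ?gt_eqF // mulr1.
  congr (_ - _); rewrite mulr_sumr; apply: eq_bigr => j _.
  rewrite hadamardE of_intE qE ?mulrA //.
  by have := p0 j; rewrite mxE.
by apply/seteqP; split=> x [bx xmax]; split=> // y /xmax;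
  rewrite !uE ler_pM2l.
Qed.

Section SingleBuyer.
Context {R : realType} {m : nat}.
Variables (s : 'rV[int]_m) (v : 'rV[int]_m -> R) (a : R) (beta : 'rV[R]_m).
Hypothesis s0 : vle 0 s.

Let u := sutility v a beta.
Let D := sdemand s v a beta.

Lemma box0 : box s 0. Proof. by split=> // j; rewrite mxE. Qed.

Lemma sdemand_box p x : D p x -> box s x. Proof. by case. Qed.

Lemma sdemand_finite p : finite_set (D p).
Proof. by apply: sub_finite_set (box_finite s) => x []. Qed.

Lemma sdemand_neq0 p : D p !=set0.
Proof.
have [|x bx xmax] := finite_argmax (u p) (box_finite s).
  by exists 0; exact: box0.
by exists x.
Qed.

Lemma VtildeE p x : D p x -> Vtilde s v a beta p = u p x.
Proof.
have uE y : v y / a - \sum_(j < m) beta 0 j * p 0 j * (y 0 j)%:~R = u p y.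
  by congr (_ - _); apply: eq_bigr => j _; rewrite hadamardE of_intE.
move=> [bx xmax]; apply/le_anti/andP; split.
  apply: ge_sup; first by exists (u p x), x; rewrite ?uE.
  by move=> _ [y by_ <-]; rewrite uE; exact: xmax.
apply: ub_le_sup; last by exists x; rewrite ?uE.
by exists (u p x) => _ [y by_ <-]; rewrite uE; exact: xmax.
Qed.

Lemma Vtilde_ge p x : box s x -> u p x <= Vtilde s v a beta p.
Proof.
move=> bx; have [y Dy] := sdemand_neq0 p.
by rewrite (VtildeE Dy); exact: Dy.2.
Qed.

Lemma sutilityD p w x :
  u (p + w) x = u p x - dotr (hadamard beta w) (of_int x).
Proof.
rewrite /u /sutility -addrA -opprD -dotrDl; congr (_ - dotr _ _).
by apply/rowP => j; rewrite !mxE mulrDr.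
Qed.

Lemma sutilityDZ p w x e :
  u (p + e *: w) x = u p x - e * dotr (hadamard beta w) (of_int x).
Proof.
rewrite sutilityD -dotrZl; congr (_ - dotr _ _).
by apply/rowP => j; rewrite !mxE mulrCA.
Qed.

Lemma near_ge_mul (g k : R) : 0 < g -> \forall e \near 0^'+, e * k <= g.
Proof.
move=> g0; near=> e; have e0 : 0 < e by near: e; exact: nbhs_right_gt.
have k1 : 0 < `|k| + 1 by rewrite ltr_wpDl.
have eg : e < g / (`|k| + 1).
  by near: e; apply: nbhs_right_lt; rewrite divr_gt0.
move: eg; rewrite ltr_pdivlMr // => /ltW; apply: le_trans.
by rewrite ler_pM2l // (le_trans (ler_norm k)) // lerDl.
Unshelve. all: by end_near. Qed.

(** Ties at [p] are broken by the cost along [w]. Any bundle not optimal at [p] has a positive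
    utility gap that a small step cannot close, and the box is finite. *)
Lemma sdemand_near p w : exists x,
  [/\ D p x,
      forall y, D p y -> dotr (hadamard beta w) (of_int x) <=
                         dotr (hadamard beta w) (of_int y)
    & \forall e \near 0^'+, D (p + e *: w) x].
Proof.
have [x Dx xmin] := finite_argmax
  (fun x => - dotr (hadamard beta w) (of_int x)) (sdemand_finite p)
  (sdemand_neq0 p).
exists x; split=> // [y /xmin|]; first by rewrite lerN2.
have /finite_seqP[t tE] := box_finite s.
suff near_le : \forall e \near 0^'+, forall k : 'I_(size t),
    u (p + e *: w) (tnth (in_tuple t) k) <= u (p + e *: w) x.
  near=> e; split=> [|y by_]; first exact: sdemand_box Dx.
  have /tnthP[k ->] : y \in in_tuple t by move: by_; rewrite tE.
  by move: k; near: e.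
apply: filter_forall => k.
set y := tnth _ _; have by_ : box s y by rewrite tE; exact: mem_tnth.
have [Dy|nDy] := pselect (D p y).
  near=> e; have e0 : 0 < e by near: e; exact: nbhs_right_gt.
  rewrite !sutilityDZ lerB ?(Dx.2 _ by_) // ler_pM2l // -lerN2; exact: xmin.
have lt_yx : u p y < u p x.
  rewrite lt_neqAle (Dx.2 _ by_) andbT; apply/eqP => e.
  by apply: nDy; split=> // z /(Dx.2); rewrite -/u -e.
have : \forall e \near 0^'+, e * (dotr (hadamard beta w) (of_int x) -
    dotr (hadamard beta w) (of_int y)) <= u p x - u p y.
  by apply: near_ge_mul; rewrite subr_gt0.
apply: filterS => e; rewrite !sutilityDZ mulrBr lerBrDr.
by rewrite addrAC lerBlDr -lerBrDl addrAC -lerBlDr addrC; lra.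
Unshelve. all: by end_near. Qed.

(** The linear cost depends only on [x + y], which an exchange preserves, so total utility does not
    drop and both new bundles are optimal. *)
Lemma Mnat_sdemand p : 0 < a -> Mnat_concave s v -> Mnat_set (D p).
Proof.
move=> a0 Mv x y Dx Dy j xy.
have [k kP vxy] := Mv x y Dx.1 Dy.1 j xy; exists k => //.
set x' := _ + chi k in vxy *; set y' := _ - chi k in vxy *.
have bx' : box s x' /\ box s y'.
  have [[x0 xs] [y0 ys]] := (Dx.1, Dy.1).
  by split; split=> l;
    [ have [] := exchange_ge xy kP (x0 l) (y0 l)
    | have [] := exchange_le xy kP (xs l) (ys l)
    | have [] := exchange_ge xy kP (x0 l) (y0 l)
    | have [] := exchange_le xy kP (xs l) (ys l)].
have sumE : x' + y' = x + y.
  by rewrite /x' /y'; apply/rowP => l; rewrite !addE; ring.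
have usum : u p x + u p y <= u p x' + u p y'.
  rewrite /u /sutility !addrA ![_ - _ + _ / a]addrAC -!addrA -!opprD -!dotrDr.
  rewrite !addrA -!mulrDl.
  have ofD : forall z w : 'rV[int]_m, of_int z + of_int w = of_int (z + w) :> 'rV[R]_m.
    by move=> z w; apply/rowP => i; rewrite !mxE intrD.
  by rewrite !ofD sumE lerD2r ler_pM2r ?invr_gt0.
have optimal z : box s z -> u p x <= u p z -> D p z.
  by move=> bz xz; split=> // t bt; apply: le_trans xz; exact: Dx.2.
have := Dx.2 _ bx'.1; have := Dy.2 _ bx'.2; rewrite -/u => y'y x'x.
have := Dx.2 _ Dy.1; have := Dy.2 _ Dx.1; rewrite -/u => xy' yx'.
by split; apply: optimal; [exact: bx'.1|lra|exact: bx'.2|lra].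
Qed.
End SingleBuyer.

Lemma minkowski_sum_finite (V : nmodType) n (B : set V) (A : 'I_n -> set V) :
  finite_set B -> (forall i, A i `<=` B) -> finite_set (minkowski_sum A).
Proof.
move=> /finite_seqP[t ->] AB.
pose f (k : {ffun 'I_n -> 'I_(size t)}) := \sum_i tnth (in_tuple t) (k i).
apply: (@sub_finite_set _ _ (f @` setT)).
  move=> _ [x Ax ->].
  have /choice[k kE] : forall i, exists k, x i = tnth (in_tuple t) k.
    by move=> i; apply/tnthP; exact: (AB i).
  exists [ffun i => k i] => //; apply: eq_bigr => i _.
  by rewrite ffunE kE.
by apply: finite_image; exact: finite_finset.
Qed.

Lemma polyhedron_fin (R : realType) m (K : finType) (a : K -> 'rV[R]_m)
    (b c : K -> R) :
  polyhedron [set z | forall k, dotr (a k) z.1 + b k * z.2 <= c k].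
Proof.
exists #|K|, (a \o enum_val), (b \o enum_val), (c \o enum_val).
apply/seteqP; split=> z Hz k; first exact: Hz.
by have := Hz (enum_rank k); rewrite /= enum_rankK.
Qed.

(* Abel summation over the superlevel sets of u. *)
Lemma superlevel_sum_ge0 (R : realDomainType) (I : finType) (u z : I -> R) :
  (forall j, 0 <= u j) ->
  (forall X : {set I}, (forall a, a \in X -> 0 < u a) ->
     (forall a b, a \in X -> b \notin X -> u b < u a) ->
     0 <= \sum_(j in X) z j) ->
  0 <= \sum_j u j * z j.
Proof.
have [N] := ubnP #|[set j | 0 < u j]%SET|; elim: N u => // N IH u uN u0 uz.
set S := [set j | 0 < u j]%SET in uN.
have inS j : (j \in S) = (0 < u j) by rewrite /S inE.
have Su j : j \notin S -> u j = 0.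
  by rewrite inS -leNgt => uj; apply/le_anti; rewrite uj u0.
have [S0|[i iS]] := set_0Vmem S.
  by rewrite big1 // => j _; rewrite Su ?mul0r // S0 inE.
have [k kS' kmin] := arg_minP u iS; have kS : k \in S := kS'.
(* Subtracting the least positive value [u k] removes [k] from the support, and superlevel sets of
   [w] remain superlevel sets of [u]. *)
pose w j := if j \in S then u j - u k else 0.
have uk0 : 0 < u k by rewrite -inS.
have -> : \sum_j u j * z j = u k * (\sum_(j in S) z j) + \sum_j w j * z j.
  rewrite mulr_sumr [X in X + _]big_mkcond -big_split; apply: eq_bigr => j _ /=.
  rewrite /w; case: ifPn => [jS|/Su->]; last by rewrite !mul0r add0r.
  by rewrite mulrBl addrC subrK.
apply: addr_ge0.
  apply: mulr_ge0 (ltW uk0) _; apply: uz => [a|a b aS bS].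
    by rewrite inS.
  by rewrite (Su b) // -inS.
apply: IH => [|j|X X0 Xw].
- apply: leq_trans (ltnSE uN); apply: proper_card; apply/properP; split.
    apply/fintype.subsetP => j; rewrite inE /w; case: ifP => //.
    by rewrite ltxx.
  by exists k => //; rewrite inE /w kS subrr ltxx.
- by rewrite /w; case: ifPn => // jS; rewrite subr_ge0 kmin.
have XS a : a \in X -> a \in S.
  by move=> /X0; rewrite /w; case: ifP => //; rewrite ltxx.
apply: uz => [a /XS|a b aX bX]; first by rewrite -inS.
have aS := XS _ aX; have := Xw a b aX bX; rewrite /w aS.
case: ifPn => [bS|/Su-> _]; first by rewrite ltrD2r.
by rewrite -inS.
Qed.

(** * The scaled Lyapunov function *)

Section Market.
Context {R : realType} {m n : nat}.
Variables (s : 'rV[int]_m) (v : 'I_n -> 'rV[int]_m -> R).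
Variables (alpha : 'rV[R]_n) (beta : 'rV[R]_m).
Hypothesis s0 : vle 0 s.

Let L := Ltilde s v alpha beta.
Let D i p := sdemand s (v i) (alpha 0 i) beta p.

Definition gradient (x : 'I_n -> 'rV[int]_m) : 'rV[R]_m :=
  hadamard beta (of_int (s - \sum_i x i)).

(** The affine function of the price that the assignment [x] contributes to the maximum [L]. *)
Definition piece (x : 'I_n -> 'rV[int]_m) (p : 'rV[R]_m) : R :=
  \sum_i v i (x i) / alpha 0 i + dotr (gradient x) p.

Lemma pieceE x p : piece x p =
  \sum_i sutility (v i) (alpha 0 i) beta p (x i)
  + \sum_(j < m) beta 0 j * p 0 j * (s 0 j)%:~R.
Proof.
rewrite /sutility sumrB -addrA; congr (_ + _).
rewrite -dotr_sumr -of_int_sum /gradient of_intB dotr_hadamardA addrC.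
have -> : \sum_(j < m) beta 0 j * p 0 j * (s 0 j)%:~R =
    dotr (hadamard beta p) (of_int s).
  by apply: eq_bigr => j _; rewrite hadamardE of_intE.
rewrite -dotrBr dotrC; apply: eq_bigr => j _.
by rewrite !hadamardE mulrAC.
Qed.

Lemma pieceD x p w : piece x (p + w) = piece x p + dotr (gradient x) w.
Proof. by rewrite /piece dotrDr addrA. Qed.

Lemma Ltilde_ge x p : (forall i, box s (x i)) -> piece x p <= L p.
Proof.
by move=> bx; rewrite pieceE lerD2r; apply: ler_sum => i _; exact: Vtilde_ge.
Qed.

Lemma LtildeE x p : (forall i, D i p (x i)) -> L p = piece x p.
Proof.
move=> Dx; rewrite pieceE; congr (_ + _).
by apply: eq_bigr => i _; exact: VtildeE (Dx i).
Qed.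

(** The piece of a demanded assignment touches [L] at [p] and lies below it everywhere. *)
Lemma Ltilde_subgradient x p y :
  (forall i, D i p (x i)) -> L p + dotr (gradient x) (y - p) <= L y.
Proof.
move=> Dx; rewrite (LtildeE Dx) -pieceD addrC subrK.
by apply: Ltilde_ge => i; exact: sdemand_box (Dx i).
Qed.

Lemma sdemand_family p : exists x, forall i, D i p (x i).
Proof.
have [x Dx] := choice (fun i => sdemand_neq0 (v i) (alpha 0 i) beta s0 p).
by exists x.
Qed.

(** Each buyer has a bundle that stays optimal for small steps along [w], so [L] follows a single
    piece there. *)
Lemma Ltilde_near p w : exists x,
  [/\ forall i, D i p (x i),
      forall i y, D i p y -> dotr (hadamard beta w) (of_int (x i)) <=
                             dotr (hadamard beta w) (of_int y)
    & \forall e \near 0^'+, L (p + e *: w) = L p + e * dotr (gradient x) w].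
Proof.
have [x Dx] := choice (fun i => sdemand_near (v i) (alpha 0 i) beta s0 p w).
have Dp i : D i p (x i) by case: (Dx i).
exists x; split=> // [i|]; first by case: (Dx i).
have : \forall e \near 0^'+, forall i, D i (p + e *: w) (x i).
  by apply: filter_forall => i; case: (Dx i).
apply: filterS => e Dxe; rewrite (LtildeE Dxe) pieceD dotrZr.
by rewrite (LtildeE Dp).
Qed.

(** Average the subgradient inequalities at the intermediate point; the linear terms cancel. *)
Lemma Ltilde_convex_comb (t : R) p q : 0 <= t <= 1 ->
  L (t *: p + (1 - t) *: q) <= t * L p + (1 - t) * L q.
Proof.
move=> /andP[t0 t1]; set z := _ + _.
have [x Dx] := sdemand_family z.
have zp := ler_wpM2l t0 (Ltilde_subgradient p Dx).
have zq : (1 - t) * (L z + dotr (gradient x) (q - z)) <= (1 - t) * L q.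
  by rewrite ler_wpM2l ?subr_ge0 //; exact: Ltilde_subgradient.
have : t * dotr (gradient x) (p - z) + (1 - t) * dotr (gradient x) (q - z) = 0.
  rewrite -!dotrZr -dotrDr.
  have -> : t *: (p - z) + (1 - t) *: (q - z) = 0.
    by apply/rowP => j; rewrite /z !mxE; ring.
  by rewrite /dotr big1 // => j _; rewrite [X in _ * X]mxE mulr0.
move: zp zq; move: (dotr _ _) (dotr _ _) (L z) (L p) (L q) => *; lra.
Qed.

(** The assignment of empty bundles gives a nonnegative lower bound. *)
Lemma Ltilde_ge0 p : (forall i, v i 0 = 0) -> (forall j, 0 <= beta 0 j) ->
  orthant p -> 0 <= L p.
Proof.
move=> v0 b0 p0; apply: le_trans (@Ltilde_ge (fun=> 0) p _).
  rewrite /piece big1 ?add0r => [|i _]; last by rewrite v0 mul0r.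
  apply: sumr_ge0 => j _; have := p0 j; have := s0 j.
  rewrite hadamardE of_intE big1 // subr0 !mxE => sj pj.
  by rewrite !mulr_ge0 // ler0z.
by move=> i; exact: box0.
Qed.

(** From an interior point, the segment to any [y] starts inside the orthant, and convexity extends
    the inequality from its beginning to [y]. *)
Lemma Ltilde_subdifferential_orthant (p : 'rV[R]_m) : (forall j, 0 < p 0 j) ->
  subdifferential orthant L p = subdifferential setT L p.
Proof.
move=> p0; apply/seteqP; split=> g gp y; last by move=> _; exact: gp.
move=> _.
have : \forall e \near (0 : R)^'+, forall j, 0 <= (p + e *: (y - p)) 0 j.
  apply: filter_forall => j.
  have := near_ge_mul (p 0 j - y 0 j) (p0 j).
  by apply: filterS => e; rewrite !mxE; lra.
have : \forall e \near (0 : R)^'+, e <= 1 by exact: nbhs_right_le.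
have : \forall e \near (0 : R)^'+, 0 < e by exact: nbhs_right_gt.
move=> H1 H2 H3.
near (0 : R)^'+ => e.
have e0 : 0 < e by near: e.
have e1 : e <= 1 by near: e.
have /gp : orthant (p + e *: (y - p)).
  by move=> j; rewrite mxE; move: j; near: e.
rewrite [p + _ - p]addrAC subrr add0r dotrZr.
have -> : p + e *: (y - p) = e *: y + (1 - e) *: p.
  by rewrite scalerBr scalerBl scale1r addrCA.
move=> le1; have := @Ltilde_convex_comb e y p.
rewrite (ltW e0) e1 => /(_ isT) le2.
have : e * dotr g (y - p) <= e * (L y - L p) by lra.
by rewrite ler_pM2l // lerBrDl.
Unshelve. all: by end_near. Qed.

Lemma Ltilde_polyhedral : polyhedral_convex orthant L.
Proof.
split=> [t p q _ _|].
  by apply: Ltilde_convex_comb; apply/andP; split.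
have /finite_seqP[sq sqE] := box_finite s.
pose x (f : {ffun 'I_n -> 'I_(size sq)}) i := tnth (in_tuple sq) (f i).
(* One inequality per sign condition on a price and one per assignment, enumerated by indices into
   [sq]. *)
pose K := ('I_m + {ffun 'I_n -> 'I_(size sq)})%type.
pose a (k : K) : 'rV[R]_m :=
  match k with inl j => - delta_mx 0 j | inr f => gradient (x f) end.
pose b (k : K) : R := if k is inr _ then -1 else 0.
pose c (k : K) : R :=
  if k is inr f then - \sum_i v i (x f i) / alpha 0 i else 0.
have -> : epigraph orthant L =
    [set z | forall k, dotr (a k) z.1 + b k * z.2 <= c k].
  have aj j (p : 'rV[R]_m) : dotr (- delta_mx 0 j) p = - p 0 j.
    rewrite /dotr (bigD1 j) //= !mxE !eqxx mulN1r big1 ?addr0 // => k /negbTE kj.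
    by rewrite !mxE kj andbF oppr0 mul0r.
  apply/seteqP; split=> [[p r] [/= p0 Lr] [j|f]|[p r] /= H].
  - by rewrite /= aj mul0r addr0 oppr_le0; have := p0 j; rewrite mxE.
  - have : piece (x f) p <= r.
      apply: le_trans Lr; apply: Ltilde_ge => i.
      by rewrite sqE; exact: mem_tnth.
    rewrite /piece /= mulN1r; move: (\sum_i _) (dotr _ _) => A B; lra.
  split=> [j|]; first by have := H (inl j); rewrite /= aj mul0r addr0 oppr_le0 mxE.
  (* The inequality of an assignment demanded at [p] already gives [L p <= r]. *)
  have [y Dy] := sdemand_family p.
  have /choice[f fE] : forall i, exists k, y i = tnth (in_tuple sq) k.
    by move=> i; apply/tnthP; have := sdemand_box (Dy i); rewrite sqE.
  have := H (inr [ffun i => f i]); rewrite /= (LtildeE Dy).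
  have -> : x [ffun i => f i] = y by apply/funext => i; rewrite /x ffunE -fE.
  rewrite /piece mulN1r; move: (\sum_i _) (dotr _ _) => A B; lra.
exact: polyhedron_fin.
Qed.

(** * Directional derivatives and subgradients *)

(** Near [p], [L] is affine along [w] with slope given by a demanded assignment, so a small step
    compares the two slopes. *)
Lemma subgradient_dir (S : set 'rV[R]_m) g p w :
  subdifferential S L p g -> (\forall e \near (0 : R)^'+, S (p + e *: w)) ->
  exists2 x, forall i, D i p (x i) & dotr g w <= dotr (gradient x) w.
Proof.
move=> gS Sw; have [x [Dx _ Lw]] := Ltilde_near p w; exists x => //.
have e0 : \forall e \near (0 : R)^'+, 0 < e by exact: nbhs_right_gt.
near (0 : R)^'+ => e; have e_gt0 : 0 < e by near: e.
have /gS : S (p + e *: w) by near: e.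
rewrite [p + _ - p]addrAC subrr add0r dotrZr.
have -> : L (p + e *: w) = L p + e * dotr (gradient x) w by near: e.
by rewrite lerD2l ler_pM2l.
Unshelve. all: by end_near. Qed.

Lemma diffquot_near p w : exists x,
  [/\ forall i, D i p (x i),
      forall i y, D i p y -> dotr (hadamard beta w) (of_int (x i)) <=
                             dotr (hadamard beta w) (of_int y)
    & \forall e \near 0^'+, diffquot L p w e = dotr (gradient x) w].
Proof.
have [x [Dx xmin Lw]] := Ltilde_near p w; exists x; split=> //.
near=> e; have e0 : 0 < e by near: e; exact: nbhs_right_gt.
rewrite /diffquot; have -> : L (p + e *: w) = L p + e * dotr (gradient x) w.
  by near: e.
by rewrite addrC addKr mulrC mulKf ?gt_eqF.
Unshelve. all: by end_near. Qed.

Lemma diffquot_cvg p w : cvg (diffquot L p w e @[e --> 0^'+]).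
Proof.
have [x [_ _ xw]] := diffquot_near p w.
by apply/cvg_ex; exists (dotr (gradient x) w); exact: cvg_near_cst.
Qed.

Lemma dirderivE p w : exists2 x, forall i, D i p (x i) &
  dirderiv L p w = dotr (gradient x) w.
Proof.
have [x [Dx _ xw]] := diffquot_near p w; exists x => //.
exact: lim_near_cst.
Qed.

Lemma hadamardK (x : 'rV[R]_m) : (forall j, beta 0 j != 0) ->
  hadamard beta (hadamard (vinv beta) x) = x.
Proof.
by move=> b0; apply/rowP => j; rewrite !hadamardE mxE mulVKf.
Qed.

Lemma subdifferential_hull p : (forall j, beta 0 j != 0) ->
  subdifferential setT L p =
  [set hadamard beta (of_int s - z)
  | z in convex_hull (of_int @` minkowski_sum (fun i => D i p))].
Proof.
move=> b0; apply/seteqP; split=> [g gp|_ [z hz <-]].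
  exists (of_int s - hadamard (vinv beta) g); last by rewrite opprB addrC subrK hadamardK.
  apply: convex_hull_finite_sep => [|w].
    apply: finite_image; apply: minkowski_sum_finite (box_finite s) _ => i x.
    exact: sdemand_box.
  (* Dividing the direction by [beta] cancels the factor [beta] of the gradients and leaves the
     pairing of [w] with bundles. *)
  have [|x Dx] := subgradient_dir (w := hadamard (vinv beta) w) gp.
    exact: nearW.
  have -> : dotr g (hadamard (vinv beta) w) = dotr w (hadamard (vinv beta) g).
    by rewrite dotrC dotr_hadamardA.
  rewrite dotr_hadamardA hadamardK // of_intB [X in _ <= X]dotrC dotrBr.
  rewrite lerBrDl -lerBrDr => gx.
  exists (of_int (\sum_i x i)); first by exists (\sum_i x i) => //; exists x.
  by rewrite dotrBr.
(* The points giving subgradients form a convex set, so only the generators of the hull need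
   checking. *)
move: z hz; apply: smallest_sub.
  apply/convex_setP => t y z /andP[t0 t1] yp zp q _.
  have tE : hadamard beta (of_int s - (t *: y + (1 - t) *: z)) =
      t *: hadamard beta (of_int s - y) + (1 - t) *: hadamard beta (of_int s - z).
    by apply/rowP => j; rewrite !mxE; ring.
  rewrite tE dotrDl !dotrZl.
  have ty := ler_wpM2l t0 (yp q I).
  have t1' : 0 <= 1 - t by rewrite subr_ge0.
  have tz := ler_wpM2l t1' (zp q I).
  move: ty tz; move: (dotr _ _) (dotr _ _) (L p) (L q) => *; lra.
move=> _ [_ [x Dx ->] <-] q _; rewrite -of_intB; exact: Ltilde_subgradient.
Qed.

Lemma subdifferential_integral p : (forall j, beta 0 j != 0) ->
  (forall i, 0 < alpha 0 i) -> (forall i, Mnat_concave s (v i)) ->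
  subdifferential setT L p `&` [set hadamard beta (of_int z) | z in setT] =
  [set hadamard beta (of_int (s - z))
  | z in minkowski_sum (fun i => D i p)].
Proof.
move=> b0 a0 Mv; apply/seteqP; split=> [g [gp [z _ zg]]|_ [_ [x Dx ->] <-]]; last first.
  split; last by exists (s - \sum_i x i).
  by move=> q _; exact: Ltilde_subgradient.
exists (s - z); last by rewrite opprB addrC subrK.
have fD i : finite_set (D i p) by exact: sdemand_finite.
apply: minkowski_integral => // [i|i|X].
- exact: Mnat_sdemand.
- exact: sdemand_neq0.
(* Pairing with [w] is minus the weight on [X], so testing the subgradient along it yields the bound
   required for [X]. *)
pose w : 'rV[R]_m := \row_j (indw X None - indw X (Some j))%:~R.
have wE y : dotr w (of_int y) = - (wsum (indw X) y)%:~R.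
  rewrite /wsum rmorph_sum -sumrN; apply: eq_bigr => j _.
  by rewrite of_intE mxE !intz rmorphM -mulNr -rmorphN opprB.
have [|x Dx] := subgradient_dir (w := hadamard (vinv beta) w) gp.
  exact: nearW.
rewrite -zg !dotr_hadamardA !hadamardK // ![dotr _ w]dotrC !wE.
rewrite lerN2 ler_int => le_zx.
have -> : wsum (indw X) (s - z) = wsum (indw X) (\sum_i x i) +
    (wsum (indw X) (s - \sum_i x i) - wsum (indw X) z).
  by rewrite !wsumB; ring.
rewrite ler_wnDr ?subr_le0 // wsum_sum; apply: ler_sum => i _.
exact: maxw_ge.
Qed.

(* Only forward directions are tested, which suffices because a minimizer lies
   above p: the derivative towards it is a sum over superlevel sets of the
   price increase, and one optimal bundle minimizes demand on all of them. *)
Lemma dirderiv_ge0_min p p' : (forall j, 0 < beta 0 j) ->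
  (forall i, 0 < alpha 0 i) -> (forall i, Mnat_concave s (v i)) ->
  vle p p' ->
  (forall X : {set 'I_m},
     0 <= dirderiv L p (hadamard (direction beta p) (charv X))) ->
  L p <= L p'.
Proof.
move=> b0 a0 Mv pp' dX.
pose w j := beta 0 j * (p' - p) 0 j.
have [x [Dx xmin _]] := Ltilde_near p (p' - p).
have sub := Ltilde_subgradient p' Dx.
apply: le_trans sub; rewrite lerDl /dotr.
have -> : \sum_j gradient x 0 j * (p' - p) 0 j =
    \sum_j w j * ((s - \sum_i x i) 0 j)%:~R.
  by apply: eq_bigr => j _; rewrite hadamardE of_intE /w mulrAC.
apply: superlevel_sum_ge0 => [j|X X0 Xw].
  by rewrite /w mulr_ge0 ?(ltW (b0 j)) // !mxE subr_ge0.
(* [y] realizes the derivative along [X]; it suffices that each buyer takes no more goods of [X]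
   under [x] than under [y]. *)
have [y Dy dE] := dirderivE p (hadamard (direction beta p) (charv X)).
have gE (z : 'I_n -> 'rV[int]_m) :
    dotr (gradient z) (hadamard (direction beta p) (charv X)) =
    \sum_(j in X) ((s - \sum_i z i) 0 j)%:~R.
  rewrite [RHS]big_mkcond; apply: eq_bigr => j _.
  rewrite !hadamardE of_intE !mxE mulrACA divff ?gt_eqF // mul1r.
  by case: (j \in X); rewrite ?mulr1 ?mulr0.
have := dX X; rewrite dE gE => /le_trans; apply.
have sumE (z : 'I_n -> 'rV[int]_m) :
    \sum_(j in X) ((s - \sum_i z i) 0 j)%:~R =
    \sum_(j in X) (s 0 j)%:~R - \sum_i \sum_(j in X) (z i 0 j)%:~R :> R.
  rewrite exchange_big -sumrB; apply: eq_bigr => j _.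
  by rewrite !addE summxE intrB rmorph_sum.
rewrite !sumE lerB //; apply: ler_sum => i _.
(* With weight 0 on the dummy good, maximizing [u] is minimizing the cost at the scaled price
   increase. *)
pose u (a : option 'I_m) : R := if a is Some j then - w j else 0.
have uE z : wsum u z = - dotr (hadamard beta (p' - p)) (of_int z).
  rewrite -sumrN; apply: eq_bigr => j _.
  by rewrite /u subr0 hadamardE of_intE mulNr.
have xu : maximizes (D i p) u (x i).
  by split=> // z Dz; rewrite !uE lerN2; exact: xmin.
(* [Y] is a superlevel set of [u], as [w] is positive on [X] and larger there than elsewhere;
   maximal weight on [Y] means fewest goods of [X]. *)
pose Y : {set option 'I_m} := ~: [set Some j | j in X]%SET.
have YE j : (Some j \in Y) = (j \notin X).
  by rewrite inE mem_imset //; exact: Some_inj.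
have NY : None \in Y by rewrite inE; apply/imsetP => -[].
have XE z : wsum (indw Y) z = - \sum_(j in X) z 0 j.
  rewrite [X in - X]big_mkcond -sumrN; apply: eq_bigr => j _.
  rewrite /indw YE NY intz; case: (j \in X); rewrite /= ?subrr ?mul0r ?oppr0 //.
  by rewrite sub0r mulN1r.
have [_ /(_ _ (Dy i))] : maximizes (D i p) (indw Y) (x i).
  apply: maximizes_level xu _; first exact: Mnat_sdemand.
  have Yneg b : b \notin Y -> exists2 j, b = Some j & j \in X.
    by case: b => [j|]; rewrite ?NY // YE negbK; exists j.
  move=> a b aY /Yneg[j -> jX]; rewrite /u.
  case: a aY => [l|_]; last by rewrite oppr_lt0 X0.
  by rewrite YE => lX; rewrite ltrN2; exact: Xw.
by rewrite !XE lerN2 -(ler_int R) !rmorph_sum.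
Qed.

End Market.

(** * Subdifferential and local optimality below the minimum equilibrium price *)

Theorem theorem6p4 (R : realType) (m n : nat) (s : 'rV[int]_m)
    (v : 'I_n -> 'rV[int]_m -> R) (q : 'I_n -> 'I_m -> R -> R)
    (alpha : 'rV[R]_n) (beta : 'rV[R]_m) (pmin : 'rV[R]_m)
    (n_ge2 : (2 <= n)%N)
    (s_ge0 : vle 0 s)
    (v_val : forall i, valuation s (v i))
    (q_pay : forall i j, payment (q i j))
    (q_reach : forall i j, box s (chi (Some j)) ->
       exists2 kappa : R, 0 <= kappa & q i j kappa = v i (chi (Some j)))
    (alpha_gt0 : forall i, 0 < alpha 0 i)
    (beta_gt0 : forall j, 0 < beta 0 j)
    (q_deriv : forall i j (x : R), 0 <= x ->
       has_right_derivative (q i j) x (alpha 0 i * beta 0 j))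
    (pmin_eq : min_equilibrium s v q pmin) :
  let L := Ltilde s v alpha beta in
  let d := direction beta in
  [/\ polyhedral_convex orthant L,
      forall p, orthant p -> 0 <= L p
    & forall p, orthant p -> vle p pmin ->
      [/\ (* (i) *)
          [/\ subdifferential setT L p =
                [set hadamard (vinv (d p)) (of_int s - z)
                | z in convex_hull (of_int @` total_demand s v q p)],
              subdifferential setT L p
                `&` [set hadamard (vinv (d p)) (of_int z) | z in setT] =
                [set hadamard (vinv (d p)) (of_int (s - z))
                | z in total_demand s v q p]
            & (forall j, 0 < p 0 j) ->
              subdifferential orthant L p = subdifferential setT L p],
          (* (ii) *)
          forall X : {set 'I_m},
            cvg (diffquot L p (hadamard (d p) (charv X)) e @[e --> 0^'+]),
          subdifferential setT L p 0 <->
            forall X : {set 'I_m},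
              0 <= dirderiv L p (hadamard (d p) (charv X))
        & subdifferential orthant L p 0 <->
            forall X : {set 'I_m},
              0 <= dirderiv L p (hadamard (d p) (charv X))]].
Proof.
have b_neq0 j : beta 0 j != 0 by rewrite gt_eqF.
have Mv i : Mnat_concave s (v i) by case: (v_val i).
move=> L d; split.
- exact: Ltilde_polyhedral.
- move=> p p0; apply: Ltilde_ge0 => // [i|j]; last exact: ltW.
  by case: (v_val i).
move=> p p0 p_le.
have demandE' p' : orthant p' ->
    total_demand s v q p' =
    minkowski_sum (fun i => sdemand s (v i) (alpha 0 i) beta p').
  move=> p'0; congr minkowski_sum; apply/funext => i.
  apply: demandE => // j x x0.
  exact: payment_linear (q_pay i j) (@q_deriv i j) x x0.
have vinv_d : vinv (d p) = beta by apply/rowP => j; rewrite !mxE invrK.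
have d_ge0 (X : {set 'I_m}) (e : R) : 0 < e ->
    orthant (p + e *: hadamard (d p) (charv X)).
  move=> e0 j; rewrite !mxE; have := p0 j; rewrite mxE => pj.
  rewrite addr_ge0 // mulr_ge0 ?(ltW e0) // mulr_ge0 ?ler0n //.
  by rewrite invr_ge0 ltW.
(* A general [S] covers both the orthant and the whole space; the test directions are nonnegative,
   so the test points stay in the orthant. *)
have forward (S : set 'rV[R]_m) : orthant `<=` S ->
    subdifferential S L p 0 -> forall X : {set 'I_m},
      0 <= dirderiv L p (hadamard (d p) (charv X)).
  move=> oS Sp X; apply: limr_ge.
    by apply: diffquot_cvg.
  have e0 : \forall e \near (0 : R)^'+, 0 < e by exact: nbhs_right_gt.
  apply: filterS e0 => e e0; rewrite /diffquot divr_ge0 ?(ltW e0) // subr_ge0.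
  have := Sp _ (oS _ (d_ge0 X e e0)).
  by rewrite /dotr big1 ?addr0 // => j _; rewrite mxE mul0r.
have backward (S : set 'rV[R]_m) :
    (forall X : {set 'I_m}, 0 <= dirderiv L p (hadamard (d p) (charv X))) ->
    subdifferential S L p 0.
  move=> dX y _.
  rewrite /dotr big1 ?addr0 => [|j _]; last by rewrite mxE mul0r.
  have [[pmin0 [x Dx xs]] _] := pmin_eq.
  apply: le_trans (dirderiv_ge0_min s_ge0 beta_gt0 alpha_gt0 Mv p_le dX) _.
  (* At [pmin] some demanded assignment exhausts the supply; its gradient is 0, so [pmin] minimizes
     [L] over the whole space. *)
  have [z Dz zs] : minkowski_sum
      (fun i => sdemand s (v i) (alpha 0 i) beta pmin) s.
    by rewrite -demandE' //; exists x.
  have := Ltilde_subgradient s_ge0 y Dz.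
  rewrite /gradient -zs subrr /dotr big1 ?addr0 // => j _.
  by rewrite hadamardE of_intE mxE mulr0 mul0r.
split.
- split.
  + by rewrite demandE' // vinv_d; exact: subdifferential_hull.
  + by rewrite demandE' // vinv_d; exact: subdifferential_integral.
  + exact: Ltilde_subdifferential_orthant.
- by move=> X; apply: diffquot_cvg.
- by split; [apply: forward|exact: backward].
- by split; [apply: forward|exact: backward].
Qed.
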